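(* Let $G=(V,E,w)$ be a finite weighted graph with a signature $\sigma:E^{or}\to U(1)$, and let $S\subseteq V$ be a nonempty subset which induces a connected subgraph. Then $$\iota^\sigma(S)=\min_{T\in\mathbb{T}_S}\sum_{\{x,y\}\in E_S}w_{xy}|\sigma_{xy}\tau_T(y)-\tau_T(x)|,$$ where $\tau_T$ denotes an arbitrary representative of $C_T(S)$. Moreover, if a function $\tau:S\to U(1)$ satisfies $\sum_{\{x,y\}\in E_S}w_{xy}|\sigma_{xy}\tau(y)-\tau(x)|=\iota^\sigma(S)$, then there is a spanning tree $T=(S,E_T)$ of the induced subgraph of $S$ such that $\tau$ is constant on $T$ with respect to $\sigma$.
   Context: $G$ is a finite undirected simple graph with edge weights $w_{xy}=w_{yx}>0$; $E^{or}=\{(x,y),(y,x)\mid\{x,y\}\in E\}$; a signature satisfies $\sigma_{yx}=\sigma_{xy}^{-1}$; $U(1)=\{z\in\mathbb{C}:|z|=1\}$. $E_S$ is the edge set of the induced subgraph of $S$. The frustration index is $\iota^\sigma(S)=\min_{\tau:S\to U(1)}\sum_{\{x,y\}\in E_S}w_{xy}|\sigma_{xy}\tau(y)-\tau(x)|$ (each summand is independent of the orientation of the edge). $\mathbb{T}_S$ is the set of all spanning trees $T=(S,E_T)$, $E_T\subseteq E_S$, of the induced subgraph of $S$. A function $\tau:S\to U(1)$ is constant on $T$ with respect to $\sigma$ if $\sigma_{xy}\tau(y)=\tau(x)$ for every oriented edge $(x,y)$ with $\{x,y\}\in E_T$. $C_T(S)$ is the (nonempty) set of all $\tau:S\to U(1)$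 that are constant on $T$ with respect to $\sigma$; any two of its elements differ by multiplication by a constant in $U(1)$. *)

(* Defs.v *)
From HB Require Import structures.
From mathcomp Require Import all_boot all_order all_algebra.
From mathcomp Require Import all_classical all_reals all_analysis.
From mathcomp Require Import complex ring lra.

Set Implicit Arguments.
Unset Strict Implicit.
Unset Printing Implicit Defensive.

Import Order.TTheory GRing.Theory Num.Theory.
Import numFieldNormedType.Exports.
Import Normc.

Local Open Scope classical_set_scope.
Local Open Scope complex_scope.
Local Open Scope ring_scope.

Definition U1 (R : realType) : set R[i] := [set z | normc z = 1].

(* The values of [wt] on non-adjacent pairs are irrelevant. *)
Record wgraph (R : realType) (V : finType) := WGraph {
  adj :> rel V;
  adj_sym : symmetric adj;
  adj_irr : irreflexive adj;
  wt : V -> V -> R;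
  wt_sym : forall x y, adj x y -> wt x y = wt y x;
  wt_gt0 : forall x y, adj x y -> 0 < wt x y }.

(* [E^or] is [adj G]; the values of [sg] on non-adjacent pairs are irrelevant. *)
Record signature (R : realType) (V : finType) (G : wgraph R V) := Signature {
  sg :> V -> V -> R[i];
  sg_U1 : forall x y, G x y -> U1 (sg x y);
  sg_inv : forall x y, G x y -> sg y x = (sg x y)^-1 }.

Section Frustration.
Context {R : realType} {V : finType}.
Implicit Types (G : wgraph R V) (S : {set V}) (F : {set {set V}}).

Definition induced_edges G S : {set {set V}} :=
  [set [set p.1; p.2] | p : V * V & [&& p.1 \in S, p.2 \in S & G p.1 p.2]]%SET.

Definition edge_rel F : rel V := fun x y => [set x; y]%SET \in F.

Definition connected_on S (r : rel V) : Prop :=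
  {in S &, forall x y, connect [rel u v | [&& u \in S, v \in S & r u v]] x y}.

(* A [ucycle] of size 1 is a loop, and one of size 2 runs back and forth along a
   single edge; a graph cycle is a [ucycle] of size at least 3. *)
Definition acyclic (r : rel V) : Prop :=
  forall c : seq V, ucycle r c -> (size c <= 2)%N.

(* A spanning tree of the induced subgraph of [S] is given by its edge set. *)
Definition spanning_trees G S : set {set {set V}} :=
  [set F : {set {set V}} | [/\ F \subset induced_edges G S,
               connected_on S (edge_rel F) & acyclic (edge_rel F)]].

(* Functions [S -> U(1)], extended arbitrarily outside [S]. *)
Definition U1_functions S : set (V -> R[i]) :=
  [set tau | {in S, forall x, U1 (tau x)}].

(* The summand of an edge [A = {x, y}], for an arbitrary choice of one of its two
   orientations; see [edge_termE]. *)
Definition edge_term G (sigma : signature G) (tau : V -> R[i])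
    (A : {set V}) : R :=
  if [pick p : V * V | A == [set p.1; p.2]%SET] is Some (x, y)
  then wt G x y * normc (sigma x y * tau y - tau x) else 0.

Definition frustration_sum G (sigma : signature G) S (tau : V -> R[i]) : R :=
  \sum_(A in induced_edges G S) edge_term sigma tau A.

(* The infimum is a minimum, see [frustration_indexP]. *)
Definition frustration_index G (sigma : signature G) S : R :=
  inf (frustration_sum sigma S @` U1_functions S).

Definition constant_on G (sigma : signature G) F (tau : V -> R[i]) : Prop :=
  forall x y, edge_rel F x y -> sigma x y * tau y = tau x.

Definition tree_constants G (sigma : signature G) S F : set (V -> R[i]) :=
  [set tau | U1_functions S tau /\ constant_on sigma F tau].

Definition is_min (A : set R) (m : R) : Prop := A m /\ lbound A m.


Lemma set2_inj (x y u v : V) : [set x; y]%SET = [set u; v]%SET ->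
  (x = u /\ y = v) \/ (x = v /\ y = u).
Proof.
move=> /setP e.
have := e x; have := e y; have := e u; have := e v.
rewrite !inE !eqxx ?orbT /= => hv hu /esym/orP[]/eqP hy /esym/orP[]/eqP hx.
- by subst; left; split=> //; move: hv; rewrite orbb => /eqP ->.
- by right.
- by left.
- by subst; left; split=> //; move: hu; rewrite orbb => /eqP ->.
Qed.

Lemma normcBC (z w : R[i]) : normc (z - w) = normc (w - z).
Proof. by rewrite -opprB normcN. Qed.

Lemma edge_termE G (sigma : signature G) tau x y : G x y ->
  edge_term sigma tau [set x; y]%SET =
  wt G x y * normc (sigma x y * tau y - tau x).
Proof.
move=> Gxy; rewrite /edge_term; case: pickP => [[u v] /= /eqP|/(_ (x, y))]; last first.
  by rewrite /= eqxx.
case/set2_inj=> -[<- <-] //.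
have s1 : normc (sigma x y) = 1 by exact: sg_U1 Gxy.
have s0 : sigma x y != 0.
  by apply/eqP => s0; move: s1; rewrite s0 normc0 => /esym/eqP; rewrite oner_eq0.
rewrite -(wt_sym Gxy); congr (_ * _).
rewrite -[LHS]mul1r -{1}s1 -normcM mulrBr (sg_inv sigma Gxy) mulrA divff// mul1r.
exact: normcBC.
Qed.

Lemma continuous_normc (T : topologicalType) (f : T -> R[i]) :
  continuous (fun t => complex.Re (f t)) ->
  continuous (fun t => complex.Im (f t)) ->
  continuous (fun t => normc (f t)).
Proof.
move=> cr ci t.
have -> : (fun t => normc (f t)) =
    (fun t => Num.sqrt (complex.Re (f t) ^+ 2 + complex.Im (f t) ^+ 2)).
  by apply/funext => u; case: (f u).
apply: (@continuous_comp _ _ _ (fun t => complex.Re (f t) ^+ 2 + complex.Im (f t) ^+ 2));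
  last exact: sqrt_continuous.
rewrite /continuous_at; apply: cvgD; rewrite !expr2; (under eq_fun do rewrite expr2); apply: cvgM;
  by [exact: cr | exact: ci].
Qed.

(* [e^(i theta)] *)
Let cis (theta : R) : R[i] := cos theta +i* sin theta.

Let cisP (z : R[i]) : U1 z -> exists2 t, t \in `[- pi, pi]%R & z = cis t.
Proof.
case: z => a b; rewrite /U1 /= => ab1.
have {}ab1 : a ^+ 2 + b ^+ 2 = 1.
  rewrite -[LHS]sqr_sqrtr ?ab1 ?expr1n//.
  by rewrite addr_ge0// sqr_ge0.
have a1 : -1 <= a <= 1.
  by rewrite -ler_norml -[leRHS]ger0_norm// -ler_sqr ?nnegrE// !real_normK ?num_real//; nra.
have aI : a \in `[-1, 1]%R by rewrite in_itv.
have sE : sin (acos a) = `|b|.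
  by rewrite sin_acos// -sqrtr_sqr; congr Num.sqrt; lra.
have p0 := acos_ge0 a1; have pp := acos_lepi a1.
have [b0|b0] := leP 0 b.
  exists (acos a); first by rewrite in_itv/= pp andbT; lra.
  by rewrite /cis acosK// sE ger0_norm.
exists (- acos a); first by rewrite in_itv/=; lra.
by rewrite /cis cosN sinN acosK// sE ltr0_norm// opprK.
Qed.

Let cisU1 t : U1 (cis t).
Proof. by rewrite /U1 /= cos2Dsin2 sqrtr1. Qed.

Lemma frustration_indexP G (sigma : signature G) S :
  is_min (frustration_sum sigma S @` U1_functions S) (frustration_index sigma S).
Proof.
pose ang (v : 'rV[R]_#|V|) x : R[i] := cis (v ord0 (enum_rank x)).
pose A : set 'rV[R]_#|V| := [set v | forall i, `[- pi, pi]%classic (v ord0 i)].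
have Ac : compact A by apply: (@rV_compact R _ (fun=> `[- pi, pi]%classic)) => i; exact: segment_compact.
have A0 : A !=set0.
  by exists 0 => i; rewrite /= in_itv /= mxE; have := @pi_ge0 R; lra.
have fc : continuous (fun v => frustration_sum sigma S (ang v)).
  apply: continuous_big => [|A' /imsetP[[x y]]].
    exact: add_continuous.
  rewrite inE => /and3P[/= _ _ Gxy] -> {A'}.
  have tc z : continuous (fun v : 'rV[R]_#|V| => v ord0 (enum_rank z)).
    exact: coord_continuous.
  have cc z : continuous (fun v : 'rV[R]_#|V| => cos (v ord0 (enum_rank z))).
    by move=> v; apply: continuous_comp; [exact: tc | exact: continuous_cos].
  have cs z : continuous (fun v : 'rV[R]_#|V| => sin (v ord0 (enum_rank z))).
    by move=> v; apply: continuous_comp; [exact: tc | exact: continuous_sin].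
  have -> : (fun v => edge_term sigma (ang v) [set x; y]%SET) =
      (fun v => wt G x y * normc (sigma x y * ang v y - ang v x)).
    by apply/funext => v; rewrite edge_termE.
  have lin a b (f g h : 'rV[R]_#|V| -> R) : continuous f -> continuous g ->
      continuous h -> continuous (fun v => a * f v + b * g v - h v).
    move=> cf cg ch v.
    pose c (r : R) := fun _ : 'rV[R]_#|V| => r.
    have cM r k : continuous k -> continuous (c r \* k).
      by move=> ck u; apply: continuousM; [exact: cst_continuous | exact: ck].
    apply: (@continuousB _ _ _ (c a \* f + c b \* g) h); last exact: ch.
    by apply: continuousD; exact: cM.
  move=> v; apply: (@cvgM _ _ (nbhs v) _ (fun=> wt G x y) _ (wt G x y)).
    exact: cvg_cst.
  apply: continuous_normc => {}v; rewrite /ang /cis; case: (sigma x y) => a b /=.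
    under eq_fun do rewrite -mulNr.
    exact: (lin a (- b) _ _ _ (cc y) (cs y) (cc x)).
  exact: (lin a b _ _ _ (cs y) (cc y) (cs x)).
have [c _ cmin] := EVT_min_rV A0 Ac (continuous_subspaceT fc).
have m : is_min (frustration_sum sigma S @` U1_functions S)
                (frustration_sum sigma S (ang c)).
  split; first by exists (ang c) => // x _; exact: cisU1.
  move=> _ [tau tauS <-].
  have tP x : exists t, t \in `[- pi, pi]%R /\ (x \in S -> tau x = cis t).
    have [xS|xS] := boolP (x \in S).
      by have [t tI ->] := cisP (tauS x xS); exists t.
    by exists 0; split=> //; rewrite in_itv /=; have := @pi_ge0 R; lra.
  have [th thP] := boolp.choice tP.
  pose v : 'rV[R]_#|V| := \row_i th (enum_val i).
  have vA : A v by move=> i; rewrite /= mxE; have [] := thP (enum_val i).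
  suff -> : frustration_sum sigma S tau = frustration_sum sigma S (ang v).
    by apply: cmin; rewrite inE.
  apply: eq_bigr => A' /imsetP[[x y]]; rewrite inE => /and3P[/= xS yS Gxy] ->.
  by rewrite !edge_termE// /ang !mxE !enum_rankK -!(proj2 (thP _)).
case: (m) => mA mlb; rewrite /frustration_index.
suff <- : frustration_sum sigma S (ang c) = inf (frustration_sum sigma S @` U1_functions S) by [].
apply/eqP; rewrite eq_le; apply/andP; split.
  by apply: lb_le_inf => //; exists (frustration_sum sigma S (ang c)).
by apply: ge_inf => //; exists (frustration_sum sigma S (ang c)).
Qed.

End Frustration.

(* Main.v *)
Require Import Defs.
From mathcomp Require Import all_boot all_order all_algebra.
From mathcomp Require Import all_classical all_reals all_analysis.
From mathcomp Require Import complex ring lra.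

Set Implicit Arguments.
Unset Strict Implicit.
Unset Printing Implicit Defensive.

Import Order.TTheory GRing.Theory Num.Theory.
Import Normc.

Local Open Scope classical_set_scope.
Local Open Scope complex_scope.
Local Open Scope ring_scope.

(** Call an edge {x, y} of the subgraph induced by S tight for tau when
    sigma x y * tau y = tau x.  Everything follows from one fact: the tight
    edges of a minimizer tau of the frustration sum connect S
    ([minimizer_tight_connected]).

    Suppose they do not, and let C be a connected component of the tight
    edges.  Multiply tau by a unit z on C only.  An edge with both ends in C,
    or both outside, contributes the same as before, while an edge leaving C
    contributes w * |c - z| for a unit c, which differs from 1 because the edge
    is not tight.  Along the circle, z |-> |c - z| is the length of a chord,
    that is 2 |sin (t / 2)| for an angle t, which is strictly concave as long
    as z does not cross c.  Hence, for z close to 1, the average of the sums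
    obtained from z and from its conjugate is smaller than the original sum as
    soon as some edge leaves C; such an edge exists because S is connected.
    One of the two rotations thus beats the minimum.

    Any spanning tree made of tight edges ([exists_spanning_tree]) is then a
    tree on which tau is constant.  Constants on a given tree differ by a global
    phase and so have the same frustration sum
    ([frustration_sum_tree_constants]): for that tree, every representative
    attains the minimum, and no representative for any tree can go below it. *)

(** * Chords of the unit circle *)

Section UnitCircle.
Context {R : realType}.
Implicit Types c u v z : R[i].

Lemma U1_neq0 z : U1 z -> z != 0.
Proof.
by rewrite /U1 /= => z1; apply/eqP => z0; move: z1; rewrite z0 normc0; lra.
Qed.

Lemma U1M z u : U1 z -> U1 u -> U1 (z * u).
Proof. by rewrite /U1 /= normcM => -> ->; rewrite mulr1. Qed.

Lemma U1V z : U1 z -> U1 z^-1.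
Proof. by rewrite /U1 /= normcV => ->; rewrite invr1. Qed.

Lemma U1_sqr (a b : R) : U1 (a +i* b) -> a ^+ 2 + b ^+ 2 = 1.
Proof.
rewrite /U1 /= => ab1.
rewrite -[LHS]sqr_sqrtr ?ab1 ?expr1n//.
by rewrite addr_ge0// sqr_ge0.
Qed.

Lemma Re_U1_lt1 z : U1 z -> z != 1 -> complex.Re z < 1.
Proof.
case: z => a b /U1_sqr ab /eqP z1 /=.
rewrite ltNge; apply/negP => a1; apply: z1.
have b0 : b = 0 by apply/eqP; rewrite -sqrf_eq0; apply/eqP; nra.
by rewrite b0; congr (_ +i* _); nra.
Qed.

(** Strict concavity of the chord length at 1, in the symmetric form
    comparing z = p + iq and its conjugate with 1; the condition Re c < p says
    that the arc from the conjugate of z to z through 1 avoids c.  With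
    a = Re c, the two chords have squares A and B with A + B = 4 (1 - ap) and
    A * B = 4 (p - a)^2, so the square of their sum is 4 (1 - a) (1 + p), to be
    compared with 8 (1 - a), the square of the right-hand side. *)
Lemma U1_chord_concave (p q : R) c : U1 (p +i* q) -> U1 c ->
  complex.Re c < p < 1 ->
  normc (c - (p +i* q)) + normc (c - (p -i* q)) < 2 * normc (c - 1).
Proof.
case: c => a b /U1_sqr pq /U1_sqr ab /= /andP[ap p1].
set A := (X in Num.sqrt X + _).
set B := (X in _ + Num.sqrt X).
set D := (X in 2 * Num.sqrt X).
have a1 : -1 <= a by nra.
have A0 : 0 <= A by rewrite addr_ge0 ?sqr_ge0.
have B0 : 0 <= B by rewrite addr_ge0 ?sqr_ge0.
have D0 : 0 <= D by rewrite addr_ge0 ?sqr_ge0.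
(* The sign of p - a is what makes the cross term rational. *)
have AB : Num.sqrt A * Num.sqrt B = 2 * (p - a).
  rewrite -sqrtrM//.
  have -> : A * B = (2 * (p - a)) ^+ 2.
    have -> : A * B = (a - p) ^+ 4 + 2 * (a - p) ^+ 2 * (b ^+ 2 + q ^+ 2)
                      + (b ^+ 2 - q ^+ 2) ^+ 2 by rewrite /A /B; ring.
    have -> : b ^+ 2 = 1 - a ^+ 2 by lra.
    have -> : q ^+ 2 = 1 - p ^+ 2 by lra.
    ring.
  by rewrite sqrtr_sqr ger0_norm//; lra.
rewrite -ltr_sqr ?nnegrE ?mulr_ge0 ?addr_ge0 ?sqrtr_ge0//.
rewrite sqrrD exprMn !sqr_sqrtr// AB /A /B /D.
nra.
Qed.

Lemma U1_chord_rotation (p q : R) u v : U1 (p +i* q) -> U1 u -> U1 v ->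
  complex.Re (u / v) < p < 1 ->
  normc (u - (p +i* q) * v) + normc (u - (p -i* q) * v) < 2 * normc (u - v).
Proof.
move=> z1 u1 v1 h.
have E z : normc (u - z * v) = normc (u / v - z).
  rewrite -[RHS]mulr1 -[X in _ = _ * X]v1 -normcM mulrBl divfK//.
  exact: U1_neq0.
have := E 1; rewrite mul1r !E => ->.
by apply: U1_chord_concave => //; apply: U1M => //; exact: U1V.
Qed.

End UnitCircle.

(** * Finite choices and connectivity *)

(** Provides the real part of a single rotation that works for all edges
    leaving the component at once; positivity keeps it above -1, so that it is
    the real part of a unit. *)
Lemma finite_lt_gap (R : realType) (I : finType) (P : pred I) (d : I -> R) :
  (forall i, P i -> d i < 1) ->
  exists p, [/\ 0 < p, p < 1 & forall i, P i -> d i < p].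
Proof.
move=> d1; pose M := \big[Order.max/0]_(i | P i) d i.
have M0 : 0 <= M by exact: bigmax_ge_id.
have M1 : M < 1 by apply/bigmax_ltP; split => //; exact: ltr01.
exists ((1 + M) / 2); split; try lra.
move=> i Pi; have : d i <= M by exact: le_bigmax_cond.
lra.
Qed.

Lemma connect_invariant (V : finType) (e : rel V) (P : pred V) x y :
  (forall u v, P u -> e u v -> P v) -> connect e x y -> P x -> P y.
Proof.
move=> step /connectP[s + ->]; elim: s x => //= z s IH x /andP[exz zs] Px.
by apply: IH => //; exact: step exz.
Qed.

(** * Spanning trees *)

Section Graph.
Context {R : realType} {V : finType} (G : wgraph R V) (S : {set V}).
Implicit Types (F : {set {set V}}).

Lemma induced_edge2P x y :
  reflect [/\ x \in S, y \in S & G x y] ([set x; y]%SET \in induced_edges G S).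
Proof.
apply: (iffP imsetP) => [[[u v]]|[xS yS Gxy]]; last first.
  by exists (x, y) => //; rewrite inE; apply/and3P.
rewrite inE => /and3P[/= uS vS Guv] /set2_inj[][-> ->] //.
by rewrite (adj_sym G).
Qed.

Lemma edge_rel_sym F : symmetric (edge_rel F).
Proof. by move=> x y; rewrite /edge_rel finset.setUC. Qed.

Lemma path_edge_relD1 F x y z p : path (edge_rel F) z p ->
  x \notin z :: p \/ y \notin z :: p ->
  path (edge_rel (F :\ [set x; y]%SET)) z p.
Proof.
elim: p z => //= v p IH z /andP[Fzv Fp] h.
apply/andP; split; last first.
  by apply: IH => //; case: h => h; [left|right]; move: h; rewrite (inE, in_cons) negb_or => /andP[].
rewrite /edge_rel !inE -/(edge_rel F z v) Fzv andbT; apply/eqP => /set2_inj E.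
by case: E h => -[-> ->] []; rewrite !inE !eqxx ?orbT.
Qed.

(** A minimal connecting subset T of F is acyclic: if T contained a cycle
    x, y, z, ..., then the rest of the cycle would join y to x without the edge
    {x, y}, which could therefore be removed. *)
Lemma exists_spanning_tree F : F \subset induced_edges G S ->
  connected_on S (edge_rel F) ->
  exists2 T : {set {set V}}, T \subset F & spanning_trees G S T.
Proof.
move=> FG Fc.
pose spans F' := `[< connected_on S (edge_rel F') >].
have /(minset_exists (P := spans))[T] : spans F by exact/asboolP.
move=> /minsetP[/asboolP Tc Tmin] TF; exists T => //; split=> //.
  exact: fintype.subset_trans TF FG.
move=> c /andP[cT cU]; rewrite leqNgt; apply/negP => c3.
case: c c3 cT cU => [|x [|y [|z c]]] // _ cT cU.
set A := [set x; y]%SET.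
have TA : A \in T by move: cT; rewrite /= => /andP[].
suff TAc : connected_on S (edge_rel (T :\ A)).
  have /setP/(_ A) := Tmin (T :\ A) (asboolT TAc) (subsetDl _ _).
  by rewrite !inE eqxx TA.
pose e F' := [rel u v | [&& u \in S, v \in S & edge_rel F' u v]].
have e_sub u v : edge_rel (T :\ A) u v -> e (T :\ A) u v.
  move=> uv; rewrite /= uv andbT.
  have : [set u; v]%SET \in T by move: uv; rewrite /edge_rel !inE => /andP[].
  by move=> /(fintype.subsetP TF)/(fintype.subsetP FG)/induced_edge2P[-> ->].
have e_sym : connect_sym (e (T :\ A)).
  apply: sym_connect_sym => u v /=.
  by rewrite edge_rel_sym; case: (u \in S); case: (v \in S).
have yx : connect (e (T :\ A)) y x.
  move: cT cU; rewrite [cycle _ _]/= rcons_path.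
  move=> /and4P[_ Tyz Tzc Tlx] /= /and3P[+ + _].
  rewrite !inE !negb_or => /and3P[xy xz xc] /andP[yz yc].
  have pT : path (edge_rel (T :\ A)) y (z :: c).
    apply: path_edge_relD1; first by rewrite /= Tyz.
    by left; rewrite !inE !negb_or xy xz.
  apply: (@connect_trans _ _ (last z c)).
    by apply/connectP; exists (z :: c) => //; exact: sub_path pT.
  (* The edge closing the cycle is not {x, y}, as its end other than x is
     neither x nor y; here the length at least 3 is used. *)
  apply/connect1/e_sub.
  rewrite /edge_rel !inE -/(edge_rel T _ _) Tlx andbT.
  apply/eqP => /set2_inj[][lx _]; have := mem_last z c; rewrite lx !inE.
    by rewrite (negPf xz) (negPf xc).
  by rewrite (negPf yz) (negPf yc).
move=> u v uS vS; apply: connect_sub (Tc _ _ uS vS) => {u v uS vS} u v /=.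
move=> /and3P[uS vS uv].
have [/set2_inj[][-> ->]|uvA] := eqVneq [set u; v]%SET A.
- by rewrite e_sym.
- exact: yx.
- by apply/connect1/e_sub; rewrite /edge_rel !inE uvA.
Qed.

End Graph.

(** * Tight edges of a minimizer *)

Section Signature.
Context {R : realType} {V : finType} {G : wgraph R V} (sigma : signature G).
Context (S : {set V}).
Implicit Types (F : {set {set V}}) (tau : V -> R[i]).

(** Membership asks for a vanishing edge term, rather than for the equation
    along the edge, so that no orientation has to be chosen. *)
Definition tight_edges tau : {set {set V}} :=
  [set A in induced_edges G S | edge_term sigma tau A == 0]%SET.

Lemma tight_edge2P tau x y :
  reflect ([/\ x \in S, y \in S & G x y] /\ sigma x y * tau y = tau x)
          (edge_rel (tight_edges tau) x y).
Proof.
rewrite /edge_rel inE; apply: (iffP andP) => -[].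
  move=> /induced_edge2P[xS yS Gxy]; rewrite edge_termE// mulf_eq0.
  rewrite gt_eqF ?wt_gt0//= => /eqP/eq0_normc/eqP.
  by rewrite subr_eq0 => /eqP.
move=> [xS yS Gxy] E; split; first exact/induced_edge2P.
by rewrite edge_termE// E subrr normc0 mulr0.
Qed.

(** Rotating tau on a component C of the tight edges by a unit near 1, or by
    its conjugate, would lower the sum if some edge left C. *)
Lemma minimizer_tight_connected tau : connected_on S G -> U1_functions S tau ->
  (forall tau', U1_functions S tau' ->
     frustration_sum sigma S tau <= frustration_sum sigma S tau') ->
  connected_on S (edge_rel (tight_edges tau)).
Proof.
move=> Gc tU tmin x0 y0 x0S y0S.
pose e := [rel u v | [&& u \in S, v \in S & edge_rel (tight_edges tau) u v]].
pose C := connect e x0.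
rewrite -/e -/(C y0).
(* The oriented edges leaving C. *)
pose bd (xy : V * V) :=
  [&& C xy.1, ~~ C xy.2, xy.1 \in S, xy.2 \in S & G xy.1 xy.2].
apply: (connect_invariant _ (Gc _ _ x0S y0S)); last exact: connect0.
(* By connectivity of S it is enough that no edge of G leaves C. *)
move=> x1 y1 Cx1 /and3P[x1S y1S G1]; apply/negPn/negP => NCy1.
pose ratio (xy : V * V) := (sigma xy.1 xy.2 * tau xy.2) / tau xy.1.
have ratio_lt1 xy : bd xy -> complex.Re (ratio xy) < 1.
  case: xy => x y /and5P[/= Cx NCy xS yS Gxy]; apply: Re_U1_lt1.
    apply: U1M; last by apply: U1V; exact: tU.
    by apply: U1M; [exact: sg_U1 | exact: tU].
  apply: contra NCy => /eqP r1; apply: connect_trans Cx _; apply: connect1.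
  rewrite /= xS yS /=; apply/tight_edge2P; split=> //.
  by rewrite -[LHS](divfK (U1_neq0 (tU _ xS))) [_ / _]r1 mul1r.
have [p [p0 p1 pr]] := finite_lt_gap ratio_lt1.
pose q := Num.sqrt (1 - p ^+ 2).
have q2 : q ^+ 2 = 1 - p ^+ 2 by rewrite sqr_sqrtr//; nra.
have zU : U1 (p +i* q) by rewrite /U1 /= q2 addrC subrK sqrtr1.
have zU' : U1 (p -i* q) by rewrite /U1 /= sqrrN q2 addrC subrK sqrtr1.
pose rot z v := if C v then z * tau v else tau v.
have rotU z : U1 z -> U1_functions S (rot z).
  by move=> z1 v vS; rewrite /rot; case: ifP => _; [apply: U1M => //|]; exact: tU.
have term_lt x y : bd (x, y) ->
    edge_term sigma (rot (p +i* q)) [set x; y]%SET +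
    edge_term sigma (rot (p -i* q)) [set x; y]%SET <
    2 * edge_term sigma tau [set x; y]%SET.
  move=> bxy; have /and5P[/= Cx NCy xS yS Gxy] := bxy.
  rewrite !edge_termE// /rot Cx (negPf NCy) -mulrDr mulrCA ltr_pM2l ?wt_gt0//.
  apply: U1_chord_rotation => //; [|exact: tU|].
    by apply: U1M; [exact: sg_U1 | exact: tU].
  by rewrite p1 andbT; exact: (pr (x, y)).
have term_same z x y : U1 z -> G x y -> C x = C y ->
    edge_term sigma (rot z) [set x; y]%SET = edge_term sigma tau [set x; y]%SET.
  move=> z1 Gxy Cxy; rewrite !edge_termE// /rot Cxy; case: ifP => // _.
  by rewrite mulrCA -mulrBr normcM z1 mul1r.
have term_le A : A \in induced_edges G S ->
    edge_term sigma (rot (p +i* q)) A + edge_term sigma (rot (p -i* q)) A <=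
    2 * edge_term sigma tau A.
  move=> /imsetP[[x y]]; rewrite inE => /and3P[/= xS yS Gxy] ->.
  case Cx : (C x); case Cy : (C y).
  - by rewrite !term_same// ?Cx ?Cy//; lra.
  - by apply/ltW/term_lt; rewrite /bd /= Cx Cy xS yS.
  - rewrite finset.setUC; apply/ltW/term_lt.
    by rewrite /bd /= Cx Cy xS yS (adj_sym G).
  - by rewrite !term_same// ?Cx ?Cy//; lra.
have A1 : [set x1; y1]%SET \in induced_edges G S by apply/induced_edge2P.
(* The edge {x1, y1} makes the comparison of the sums strict. *)
have : frustration_sum sigma S (rot (p +i* q)) +
       frustration_sum sigma S (rot (p -i* q)) <
       2 * frustration_sum sigma S tau.
  rewrite /frustration_sum -big_split mulr_sumr /= !(bigD1 _ A1) /=.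
  apply: ltr_leD; first by apply: term_lt; rewrite /bd /= Cx1 NCy1 x1S y1S.
  by apply: ler_sum => A /andP[+ _]; exact: term_le.
have := tmin _ (rotU _ zU); have := tmin _ (rotU _ zU'); lra.
Qed.

Lemma minimizer_constant_on_tree tau : connected_on S G -> U1_functions S tau ->
  frustration_sum sigma S tau = frustration_index sigma S ->
  exists T, spanning_trees G S T /\ constant_on sigma T tau.
Proof.
move=> Gc tU tmin.
have [_ lb] := frustration_indexP sigma S.
have tightG : tight_edges tau \subset induced_edges G S.
  by apply/fintype.subsetP => A; rewrite inE => /andP[].
have [|T Ttight Ttree] := exists_spanning_tree tightG.
  apply: minimizer_tight_connected => // tau' tU'.
  by rewrite tmin; apply: lb; exists tau'.
by exists T; split=> // x y /(fintype.subsetP Ttight)/tight_edge2P[].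
Qed.

(** Along a tree edge the value at one end determines the value at the other,
    so two constants differ by the global phase k read off at any vertex x0, and
    the norms in the frustration sum do not see a global phase. *)
Lemma frustration_sum_tree_constants F tau tau' : (exists x, x \in S) ->
  spanning_trees G S F ->
  tree_constants sigma S F tau -> tree_constants sigma S F tau' ->
  frustration_sum sigma S tau = frustration_sum sigma S tau'.
Proof.
move=> [x0 x0S] [FG Fc _] [tU tc] [tU' tc'].
pose k := tau' x0 / tau x0.
have kU : U1 k by apply: U1M; [exact: tU' | apply: U1V; exact: tU].
have ktau x : x \in S -> tau' x = k * tau x.
  move=> xS; apply/eqP.
  apply: (connect_invariant (P := fun v => tau' v == k * tau v) _ (Fc _ _ x0S xS)).
    move=> u v /= /eqP uk /and3P[uS vS uv].
    have [_ _ Guv] := induced_edge2P _ _ _ _ (fintype.subsetP FG _ uv).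
    apply/eqP/(mulfI (U1_neq0 (sg_U1 sigma Guv))).
    by rewrite mulrCA (tc _ _ uv) (tc' _ _ uv).
  by rewrite /k divfK// U1_neq0//; exact: tU.
apply: eq_bigr => A /imsetP[[x y]]; rewrite inE => /and3P[/= xS yS Gxy] ->.
by rewrite !edge_termE// !ktau// mulrCA -mulrBr normcM kU mul1r.
Qed.

End Signature.

Theorem theorem4p10 (R : realType) (V : finType) (G : wgraph R V)
    (sigma : signature G) (S : {set V}) :
  (exists x, x \in S) -> connected_on S G ->
  (forall rep : {set {set V}} -> V -> R[i],
    (forall T, spanning_trees G S T -> tree_constants sigma S T (rep T)) ->
    is_min [set frustration_sum sigma S (rep T) | T in spanning_trees G S]
           (frustration_index sigma S)) /\
  (forall tau : V -> R[i], U1_functions S tau ->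
    frustration_sum sigma S tau = frustration_index sigma S ->
    exists T, spanning_trees G S T /\ constant_on sigma T tau).
Proof.
move=> S0 Gc; split=> [rep repT|tau]; last exact: minimizer_constant_on_tree.
have [[tau tU tmin] lb] := frustration_indexP sigma S.
split=> [|_ [T Ttree <-]]; last by apply: lb; exists (rep T) => //; have [] := repT _ Ttree.
have [T [Ttree Tc]] := minimizer_constant_on_tree Gc tU tmin.
exists T => //; rewrite -tmin.
by apply: (frustration_sum_tree_constants S0 Ttree (repT _ Ttree)); split.
Qed.
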